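(* Let the players be symmetric, i.e. $a_i=a$ for all $i=1,\dots,N$, and let $\mathcal P=\{p\mathbf 1: p\in\mathbb R\}$. For all $i$, let $v_i(z)=1-\exp(-\lambda z)$ for some $\lambda>0$ (the same for all $i$). Then, for $\mathbf p\in\mathcal P$, $|\widetilde X^*(\mathbf p)|=1$, and $\mathbf x^*\in\widetilde X^*(\mathbf p)$ satisfies $x_i^*-y_i=x_1^*-y_1$ for all players $i=1,\dots,N$.
   Context: Setting. Players $i=1,\dots,N$ choose strategies $x_i\in\mathcal X_i\subset\mathbb R$, where each $\mathcal X_i$ is compact and convex; $\mathcal X=\prod_{i=1}^N\mathcal X_i$. Constants: targets $\mathbf y=(y_1,\dots,y_N)$, $a_i>0$, $b_i\ge 0$. A price vector $\mathbf p=(p_1,\dots,p_N)\in\mathcal P$ is fixed by a coordinator. $\mathbf 1$ is the all-ones vector. The random variable $\xi$ takes values in a finite set $\Xi=\{\xi_1,\dots,\xi_M\}$ of reals with distribution $q=(q_1,\dots,q_M)$, and has positive variance. The outcome of player $i$ is $$J_i(x_i,\mathbf x_{-i},\mathbf p,\xi)=-a_i\Big(\tfrac1N\sum_{j=1}^N x_j-\tfrac1N\sum_{j=1}^N y_j\Big)^2+b_i-p_ix_i-(y_i-x_i)\xi ,$$ where $\mathbf x_{-i}$ is $\mathbf x$ with the $i$-th component removed. PT game: given value functions $v_i$, the utilities are $\widetilde J_i(x_i,\mathbf x_{-i},\mathbf p)=\sum_{k=1}^M q_k\,v_i\big(J_i(x_i,\mathbf x_{-i},\mathbf p,\xi_k)\big)$.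 A joint strategy $\mathbf x^*\in\mathcal X$ is a Nash equilibrium of the PT game at $\mathbf p$ if $\widetilde J_i(x_i^*,\mathbf x_{-i}^*,\mathbf p)\ge\widetilde J_i(x_i,\mathbf x_{-i}^*,\mathbf p)$ for all $x_i\in\mathcal X_i$ and all $i=1,\dots,N$. The set of these is $\widetilde X^*(\mathbf p)$.
   Formalization: The identity x_i*−y_i = x_1*−y_1 is claimed only if every x_i* is interior to X_i or all sets X_i−y_i coincide; it fails for general compact convex X_i (e.g. X_1=X_2=[0,1], y=(0,1), large p). The X_i are also assumed nonempty. *)

(* Defs.v *)
From mathcomp Require Import all_boot all_order all_algebra.
From mathcomp Require Import all_classical all_reals all_analysis.

Set Implicit Arguments.
Unset Strict Implicit.
Unset Printing Implicit Defensive.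

Import Order.TTheory GRing.Theory Num.Theory.
Import numFieldNormedType.Exports.
Local Open Scope classical_set_scope.
Local Open Scope ring_scope.

Section FiniteLotteries.
Context {R : realType} {M : nat}.
Implicit Types q f : 'I_M -> R.

Definition is_distribution q := (forall k, 0 <= q k) /\ \sum_k q k = 1.

Definition expect q f : R := \sum_k q k * f k.

Definition finite_variance q f : R :=
  expect q (fun k => (f k - expect q f) ^+ 2).

End FiniteLotteries.

Section Game.
Context {R : realType} {N : nat}.
Implicit Types (a b : 'I_N -> R) (y p x : 'rV[R]_N) (X : 'I_N -> set R).

(* The outcome J_i is written as a function of the whole profile x, own
   strategy included; the pair (t, x_{-i}) is the profile [deviate x i t]. *)
Definition outcome a b y p (i : 'I_N) x (xi : R) : R :=
  - a i * ((\sum_j x ord0 j) / N%:R - (\sum_j y ord0 j) / N%:R) ^+ 2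
  + b i - p ord0 i * x ord0 i - (y ord0 i - x ord0 i) * xi.

Definition deviate x (i : 'I_N) (t : R) : 'rV[R]_N :=
  \row_j (if j == i then t else x ord0 j).

Definition strategy_space X : set 'rV[R]_N :=
  [set x | forall i, X i (x ord0 i)].

Definition uniform_prices : set 'rV[R]_N :=
  [set p | exists c : R, p = const_mx c].

Definition pt_utility {M : nat} a b y (q xi : 'I_M -> R) (v : 'I_N -> R -> R)
    p (i : 'I_N) x : R :=
  expect q (fun k => v i (outcome a b y p i x (xi k))).

Definition pt_nash X {M : nat} a b y (q xi : 'I_M -> R) (v : 'I_N -> R -> R)
    p : set 'rV[R]_N :=
  [set x | strategy_space X x /\
    forall i t, X i t ->
      pt_utility a b y q xi v p i (deviate x i t)
        <= pt_utility a b y q xi v p i x].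

End Game.

(* Main.v *)
Require Import Defs.
From mathcomp Require Import all_boot all_order all_algebra.
From mathcomp Require Import all_classical all_reals all_analysis.
From mathcomp Require Import ring lra.

(** With prices all equal to [c], the utility of player [i] is
    [1 - C_i * expR (lambda a s^2) * m (x_i - y_i)], where [C_i > 0], [s] is the
    mean of the deviations [x_j - y_j], and [m] is the moment generating
    function of [- lambda (xi - c)]. Hence [expR (lambda a s^2)] times the
    product of the [m (x_j - y_j)] is a potential, and a minimiser of it over
    the compact strategy space is an equilibrium. The logarithmic derivative of
    [m] is strictly increasing because [xi] is not constant, so the variational
    inequalities satisfied by the equilibria are strictly monotone, whence
    uniqueness. At an interior equilibrium each deviation is a root of the same
    strictly monotone equation; with identical sets of admissible deviations,
    two distinct ones contradict the variational inequalities of the two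
    players. *)

Set Implicit Arguments.
Unset Strict Implicit.
Unset Printing Implicit Defensive.

Import Order.TTheory GRing.Theory Num.Theory.
Import numFieldNormedType.Exports.
Local Open Scope classical_set_scope.
Local Open Scope ring_scope.

(** * Limits, continuity and a tangent bound for the exponential *)

Lemma continuous_right_ge0 (R : realType) (f : R -> R) :
  {for 0, continuous f} -> (forall e, 0 < e -> e <= 1 -> 0 <= f e) -> 0 <= f 0.
Proof.
move=> /cvg_at_right_filter cf f_ge0; apply: (cvgr_to_ge cf).
near=> e; apply: f_ge0; near: e; first exact: nbhs_right_gt.
exact: nbhs_right_le.
Unshelve. all: by end_near. Qed.

Lemma continuous_sum (R : realType) (T : topologicalType) (I : finType)
    (F : I -> T -> R) :
  (forall i, continuous (F i)) -> continuous (fun t => \sum_i F i t).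
Proof. by move=> cF; apply: continuous_big => //; exact: add_continuous. Qed.

Lemma continuous_prod (R : realType) (T : topologicalType) (I : finType)
    (F : I -> T -> R) :
  (forall i, continuous (F i)) -> continuous (fun t => \prod_i F i t).
Proof. by move=> cF; apply: continuous_big => //; exact: mul_continuous. Qed.

Lemma expRB_le (R : realType) (u w : R) : expR u - expR w <= expR u * (u - w).
Proof.
have := expR_ge1Dx (w - u); rewrite -(ler_pM2l (expR_gt0 u)) -expRD subrKC.
by move=> h; lra.
Qed.

(** * Exponentially tilted means of a finite lottery *)

Section ExponentialTilting.
Context {R : realType} {M : nat} (q : 'I_M -> R).
Hypothesis q_distr : is_distribution q.
Implicit Types z : 'I_M -> R.

(** Positive variance in the form in which it is used: the ordered pair [k], [l] singles out a
    strictly positive term of a double sum. *)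
Definition nonconstant z :=
  exists k l, [/\ 0 < q k, 0 < q l & z k < z l].

Lemma finite_variance_nonconstant z :
  0 < finite_variance q z -> nonconstant z.
Proof.
case: q_distr => q_ge0 q_sum1.
set m := expect q z => var_gt0.
have [k /=] : exists k, true && (0 < q k * (z k - m) ^+ 2).
  apply: psumr_neq0P => [i _|]; first by rewrite mulr_ge0 ?sqr_ge0.
  by apply/eqP; rewrite gt_eqF.
rewrite lt0r mulf_eq0 negb_or sqrf_eq0 subr_eq0 => /andP[/andP[qk zk] _].
have qk_gt0 : 0 < q k by rewrite lt0r qk q_ge0.
(* If every value of positive probability equalled [z k], then [m] would be [z k]. *)
have [l /andP[ql zl]|all_eq] := pickP (fun l => (0 < q l) && (z l != z k)).
  by case: (ltgtP (z l) (z k)) zl => // h _; [exists l, k | exists k, l].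
case/negP: zk; rewrite /m /expect -[z k]mul1r -q_sum1 mulr_suml.
apply/eqP/eq_bigr => l _; have := all_eq l.
have [->|ql] := eqVneq (q l) 0; first by rewrite !mul0r.
by rewrite lt0r ql q_ge0 /= => /negbFE/eqP->.
Qed.

Definition mgf z (d : R) : R := expect q (fun k => expR (- (d * z k))).

(* Minus the logarithmic derivative of [mgf z]. *)
Definition tilted_mean z (d : R) : R :=
  expect q (fun k => expR (- (d * z k)) * z k) / mgf z d.

Lemma mgf_gt0 z d : 0 < mgf z d.
Proof.
case: q_distr => q_ge0 q_sum1; rewrite lt0r sumr_ge0 ?andbT; last first.
  by move=> k _; rewrite mulr_ge0 ?expR_ge0.
apply/eqP => /(psumr_eq0P (fun k _ => mulr_ge0 (q_ge0 k) (expR_ge0 _))) q0.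
have /eqP : (1 : R) != 0 by exact: oner_neq0.
case; rewrite -q_sum1 big1 // => k _.
by have /eqP := q0 k isT; rewrite mulf_eq0 expR_eq0 orbF => /eqP.
Qed.

Lemma continuous_mgf z : continuous (mgf z).
Proof.
apply: continuous_sum => k d.
apply: cvgM; first exact: cvg_cst.
apply: continuous_comp; last exact: continuous_expR.
by apply: cvgN; apply: cvgM; [exact: cvg_id|exact: cvg_cst].
Qed.

(* Clearing denominators and symmetrising in the two summation indices, the
   difference is a sum of terms [(z k - z l) * D k l], each nonnegative. *)
Lemma tilted_mean_decreasing z :
  nonconstant z -> {homo tilted_mean z : d e /~ d < e}.
Proof.
move=> [k0 [l0 [qk0 ql0 zkl]]] e d lt_de.
case: q_distr => q_ge0 _.
rewrite /tilted_mean ltr_pdivrMr ?mgf_gt0 // mulrAC ltr_pdivlMr ?mgf_gt0 //.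
pose w c k := q k * expR (- (c * z k)).
pose D k l := w d k * w e l - w e k * w d l.
have DE : expect q (fun k => expR (- (d * z k)) * z k) * mgf z e
          - expect q (fun k => expR (- (e * z k)) * z k) * mgf z d
          = \sum_k \sum_l z k * D k l.
  rewrite !big_distrlr -sumrB; apply: eq_bigr => k _.
  by rewrite -sumrB; apply: eq_bigr => l _; rewrite /D /w /=; ring.
have D_sym : (\sum_k \sum_l z k * D k l) *+ 2
             = \sum_k \sum_l (z k - z l) * D k l.
  rewrite mulr2n {2}exchange_big -big_split; apply: eq_bigr => k _.
  by rewrite -big_split; apply: eq_bigr => l _; rewrite /D /=; ring.
have DF k l : D k l =
    q k * q l * (expR (- (d * z k + e * z l)) - expR (- (e * z k + d * z l))).
  by rewrite /D /w !opprD !expRD; ring.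
(* The exponents in [DF] differ by [(e - d) * (z k - z l)], so the difference of exponentials has
   the sign of [z k - z l]. *)
have DD_ge0 k l : 0 <= (z k - z l) * D k l.
  rewrite DF mulrCA; apply: mulr_ge0; first exact: mulr_ge0.
  have [le_lk|lt_kl] := leP (z l) (z k).
    by rewrite mulr_ge0 ?subr_ge0 // ler_expR; nra.
  by rewrite mulr_le0 ?subr_le0 ?ler_expR ?ltW //; nra.
(* Strictness comes from the single term with indices [k0], [l0]. *)
rewrite -subr_gt0 DE -(pmulrn_lgt0 _ (ltn0Sn 1)) D_sym (bigD1 k0) //=.
apply: ltr_wpDr; first by do 2!apply: sumr_ge0 => ? _.
rewrite (bigD1 l0) //=; apply: ltr_wpDr; first by apply: sumr_ge0 => ? _.
rewrite DF mulrCA; apply: mulr_gt0; first exact: mulr_gt0.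
rewrite nmulr_lgt0 ?subr_lt0 //.
by rewrite ltr_expR; nra.
Qed.

Lemma tilted_mean_antimonotone z d e : nonconstant z ->
  (tilted_mean z d - tilted_mean z e) * (d - e) <= 0 ?= iff (d == e).
Proof.
move=> /tilted_mean_decreasing dec; apply/leifP.
case: (ltgtP d e) => [lt_de|lt_ed|->]; last by rewrite !subrr mulr0.
  by rewrite pmulr_rlt0 ?subr_lt0 ?subr_gt0 // dec.
by rewrite pmulr_llt0 ?subr_lt0 ?subr_gt0 // dec.
Qed.

(* Convexity of [expR] bounds the increment of the cost by [e] times a function
   of [e] continuous at [0], so no derivative has to be taken. *)
Lemma tilted_first_order z kappa s d h delta :
  (forall e, 0 < e -> e <= 1 ->
     expR (kappa * s ^+ 2) * mgf z d
       <= expR (kappa * (s + e * h) ^+ 2) * mgf z (d + e * delta)) ->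
  0 <= kappa * (s * h) *+ 2 - tilted_mean z d * delta.
Proof.
move=> cost_min.
(* [u k e] is the exponent of the [k]-th term of the perturbed cost and [r k e] is
   [(u k e - u k 0) / e]. By [expRB_le] the cost increases by at most [e * F e], hence [0 <= F e]
   for small [e > 0]. *)
pose u k e := kappa * (s + e * h) ^+ 2 - (d + e * delta) * z k.
pose r k e := kappa * (s * h) *+ 2 + e * (kappa * h ^+ 2) - delta * z k.
pose F e := \sum_k q k * (expR (u k e) * r k e).
have costE e : expR (kappa * (s + e * h) ^+ 2) * mgf z (d + e * delta) =
    \sum_k q k * expR (u k e).
  rewrite /mgf /expect mulr_sumr; apply: eq_bigr => k _.
  by rewrite /u expRD; ring.
have F_ge0 : 0 <= F 0.
  apply: continuous_right_ge0 => [|e e_gt0 e_le1].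
    apply: continuous_sum => k e; apply: cvgM; first exact: cvg_cst.
    have clin (a b : R) : continuous (fun t : R => a + t * b).
      move=> t; apply: cvgD; first exact: cvg_cst.
      by apply: cvgM; [exact: cvg_id|exact: cvg_cst].
    apply: cvgM; last first.
      by apply: cvgB; [exact: clin|exact: cvg_cst].
    apply: continuous_comp; last exact: continuous_expR.
    apply: cvgB; last by apply: cvgM; [exact: clin|exact: cvg_cst].
    apply: cvgM; first exact: cvg_cst.
    by apply: cvgM; exact: clin.
  rewrite -(pmulr_rge0 _ e_gt0); have := cost_min e e_gt0 e_le1.
  have := costE 0; rewrite !mul0r !addr0 => -> ; rewrite costE.
  rewrite -subr_ge0 -sumrB => /le_trans; apply.
  rewrite mulr_sumr; apply: ler_sum => k _.
  rewrite -mulrBr mulrCA ler_wpM2l //; first by case: q_distr.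
  apply: (le_trans (expRB_le _ _)).
  by rewrite mulrCA ler_wpM2l ?expR_ge0 // /u /r le_eqVlt; apply/orP; left;
    apply/eqP; ring.
suff FE : F 0 = expR (kappa * s ^+ 2) * mgf z d *
    (kappa * (s * h) *+ 2 - tilted_mean z d * delta).
  by move: F_ge0; rewrite FE pmulr_rge0 // mulr_gt0 ?expR_gt0 ?mgf_gt0.
have mgf_neq0 : mgf z d != 0 by rewrite gt_eqF ?mgf_gt0.
rewrite mulrBr -mulrA.
have -> : expR (kappa * s ^+ 2) * (mgf z d * (kappa * (s * h) *+ 2)) -
   expR (kappa * s ^+ 2) * mgf z d * (tilted_mean z d * delta) =
   expR (kappa * s ^+ 2) * (mgf z d * (kappa * (s * h) *+ 2)
     - expect q (fun k => expR (- (d * z k)) * z k) * delta).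
  by rewrite /tilted_mean; field.
rewrite /mgf /expect !mulr_suml -sumrB mulr_sumr; apply: eq_bigr => k _.
by rewrite /u /r !mul0r !addr0 expRD; ring.
Qed.

End ExponentialTilting.

(** * Existence, uniqueness and symmetry of equilibria of the cost game *)

Section ExponentialGame.
Context {R : realType} {N M : nat}.
Variables (y : 'rV[R]_N) (X : 'I_N -> set R) (q z : 'I_M -> R) (kappa : R).
Hypothesis N_gt0 : (0 < N)%N.
Hypothesis q_distr : is_distribution q.
Hypothesis z_nonconstant : nonconstant q z.
Hypothesis kappa_ge0 : 0 <= kappa.
Hypothesis X_convex : forall i, convex_set (X i : set R^o).
Implicit Types x : 'rV[R]_N.

Definition mean_deviation x : R :=
  (\sum_j x ord0 j) / N%:R - (\sum_j y ord0 j) / N%:R.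

Definition exp_cost (i : 'I_N) x : R :=
  expR (kappa * mean_deviation x ^+ 2) * mgf q z (x ord0 i - y ord0 i).

Definition cost_nash : set 'rV[R]_N :=
  [set x | strategy_space X x /\
    forall i t, X i t -> exp_cost i x <= exp_cost i (deviate x i t)].

Let NR_neq0 : N%:R != 0 :> R. Proof. by rewrite pnatr_eq0 -lt0n. Qed.

Lemma mean_deviation_deviate x i t :
  mean_deviation (deviate x i t)
    = mean_deviation x + (t - x ord0 i) / N%:R.
Proof.
rewrite /mean_deviation; suff -> : \sum_j deviate x i t ord0 j
    = \sum_j x ord0 j + (t - x ord0 i) by field.
rewrite (bigD1 i) // [in RHS](bigD1 i) //= mxE eqxx.
rewrite (eq_bigr (x ord0)) => [|j /negbTE ji]; last by rewrite mxE ji.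
by ring.
Qed.

Definition potential x : R :=
  expR (kappa * mean_deviation x ^+ 2) * \prod_j mgf q z (x ord0 j - y ord0 j).

Lemma potential_exp_cost i x :
  potential x
    = exp_cost i x * \prod_(j | j != i) mgf q z (x ord0 j - y ord0 j).
Proof. by rewrite /potential (bigD1 i) //= mulrA. Qed.

Lemma continuous_potential : continuous potential.
Proof.
have cE j : continuous (fun x : 'rV[R]_N => x ord0 j).
  exact: coord_continuous.
have cs : continuous mean_deviation.
  move=> x; apply: (@cvgB _ _ _ (nbhs x)); last exact: cvg_cst.
  apply: (@cvgM _ _ (nbhs x)); last exact: cvg_cst.
  exact: continuous_sum.
move=> x; apply: (@cvgM _ _ (nbhs x)).
  apply: (@continuous_cvg _ _ _ (nbhs x) _ _ (@expR R)).
    exact: continuous_expR.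
  apply: (@cvgM _ _ (nbhs x)); first exact: cvg_cst.
  by apply: (@cvgM _ _ (nbhs x)); exact: cs.
apply: continuous_prod => j {}x.
apply: (@continuous_cvg _ _ _ (nbhs x) _ _ (mgf q z)).
  exact: continuous_mgf.
by apply: (@cvgB _ _ _ (nbhs x)); [exact: cE|exact: cvg_cst].
Qed.

Lemma cost_nash_exists : (forall i, X i !=set0) -> (forall i, compact (X i)) ->
  cost_nash !=set0.
Proof.
move=> X_nonempty X_compact.
have [|x /set_mem Sx x_min] :=
  EVT_min_rV _ (rV_compact X_compact)
    (continuous_subspaceT continuous_potential).
  have /choice[f Xf] := X_nonempty.
  by exists (\row_j f j) => i; rewrite mxE.
exists x; split=> // i t Xt.
have := x_min (deviate x i t); rewrite !(potential_exp_cost i).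
(* The factors of the other players are positive and unaffected by the deviation, so they cancel. *)
have -> : \prod_(j | j != i) mgf q z (deviate x i t ord0 j - y ord0 j)
    = \prod_(j | j != i) mgf q z (x ord0 j - y ord0 j).
  by apply: eq_bigr => j /negbTE ji; rewrite mxE ji.
rewrite ler_pM2r ?prodr_gt0 // => [|j _]; last exact: mgf_gt0.
by apply; apply/mem_set => j; rewrite mxE; case: eqP => [->|_].
Qed.

(** By convexity player [i] may move a fraction [e] of the way towards [t], which shifts the mean by
    [e * d / N%:R]; optimality along this segment gives the inequality. *)
Lemma cost_nash_first_order x i t : cost_nash x -> X i t ->
  0 <= (kappa * mean_deviation x / N%:R *+ 2
        - tilted_mean q z (x ord0 i - y ord0 i)) * (t - x ord0 i).
Proof.
move=> [Sx x_min] Xt; set d := t - x ord0 i.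
have := @tilted_first_order R M q q_distr z kappa (mean_deviation x)
  (x ord0 i - y ord0 i) (d / N%:R) d.
set g := (X in (_ -> 0 <= X) -> _); set g' := (X in _ -> 0 <= X).
have -> : g = g' by rewrite /g /g'; ring.
apply=> e e_gt0 e_le1.
have Xe : X i (x ord0 i + e * d).
  have := X_convex (Itv01 (ltW e_gt0) e_le1) (mem_set Xt) (mem_set (Sx i)).
  rewrite inE; congr (X i _); apply: etrans (convRE _ _ _) _.
  by rewrite /unstable.onem /= /d; ring.
have := x_min i _ Xe; rewrite /exp_cost mean_deviation_deviate mxE eqxx.
congr (_ <= expR (kappa * (_ + _) ^+ 2) * mgf q z _); last by ring.
by rewrite addrAC subrr add0r mulrA.
Qed.

Lemma cost_nash_unique x x' : cost_nash x -> cost_nash x' -> x = x'.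
Proof.
move=> Nx Nx'; have [[Sx _] [Sx' _]] := (Nx, Nx').
pose d i := x ord0 i - y ord0 i; pose d' i := x' ord0 i - y ord0 i.
pose T i := (tilted_mean q z (d i) - tilted_mean q z (d' i)) * (d i - d' i).
have T_le0 i : T i <= 0 ?= iff (d i == d' i) by exact: tilted_mean_antimonotone.
set ds := mean_deviation x - mean_deviation x'.
have dsE : \sum_i (x ord0 i - x' ord0 i) = N%:R * ds.
  by rewrite sumrB /ds /mean_deviation; field.
have sumT : 0 <= \sum_i T i.
  (* Testing each equilibrium's inequality at the other one bounds [T i] below by a term linear in
     [x ord0 i - x' ord0 i]; these terms sum to [kappa * ds ^+ 2 *+ 2]. *)
  apply: (@le_trans _ _ (kappa * ds ^+ 2 *+ 2)).
    by rewrite mulrn_wge0 // mulr_ge0 ?sqr_ge0.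
  have -> : kappa * ds ^+ 2 *+ 2
    = \sum_i kappa * ds / N%:R *+ 2 * (x ord0 i - x' ord0 i).
    by rewrite -mulr_sumr dsE; field.
  apply: ler_sum => i _.
  have := cost_nash_first_order Nx (Sx' i).
  have := cost_nash_first_order Nx' (Sx i).
  by rewrite /T /ds /d /d'; lra.
(* Nonpositive terms with a nonnegative sum all vanish. *)
have T0 : forall i, T i = 0.
  move=> i; apply: oppr_inj; rewrite oppr0.
  apply: (psumr_eq0P (P := xpredT) (F := fun i => - T i)) => // [j _|].
    by rewrite oppr_ge0 T_le0.
  apply/eqP; rewrite sumrN oppr_eq0 eq_le sumT andbT.
  by apply: sumr_le0 => j _; rewrite T_le0.
apply/rowP => i; have := T_le0 i; rewrite T0 => /leifP.
by case: eqP => [/addIr //|_]; rewrite ltxx.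
Qed.

(** Steps of [r / 2] in both directions are admissible, so the first-order factor is both
    nonnegative and nonpositive. *)
Lemma cost_nash_interior x i : cost_nash x -> interior (X i) (x ord0 i) ->
  tilted_mean q z (x ord0 i - y ord0 i)
    = kappa * mean_deviation x / N%:R *+ 2.
Proof.
move=> Nx /nbhs_ballP[r /= r_gt0 rX].
have r2_gt0 : 0 < r / 2 by rewrite divr_gt0.
have ltr2 : `|r / 2| < r by rewrite gtr0_norm // ltr_pdivrMr //; lra.
have Xp : X i (x ord0 i + r / 2).
  by apply: rX; rewrite -ball_normE /= opprD addNKr normrN.
have Xm : X i (x ord0 i - r / 2).
  by apply: rX; rewrite -ball_normE /= opprB addrC subrK.
have := cost_nash_first_order Nx Xp; have := cost_nash_first_order Nx Xm.
by rewrite [_ - _ - x _ _]addrAC subrr add0r [_ + _ - x _ _]addrAC subrr add0r;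
  nra.
Qed.

Lemma cost_nash_symmetric x i j : cost_nash x ->
  (forall k, interior (X k) (x ord0 k)) \/
    [set t - y ord0 i | t in X i] = [set t - y ord0 j | t in X j] ->
  x ord0 i - y ord0 i = x ord0 j - y ord0 j.
Proof.
move=> Nx sym; have [Sx _] := Nx; apply/eqP.
(* Equality of the deviations is the equality case of antimonotonicity, so it remains to show that
   the product is nonnegative. *)
rewrite -(tilted_mean_antimonotone q_distr _ _ z_nonconstant).
rewrite eq_le (tilted_mean_antimonotone q_distr _ _ z_nonconstant) /=.
case: sym => [Xint|Xij]; first by rewrite !cost_nash_interior // subrr mul0r.
(* Each of the two players can adopt the deviation of the other; adding their inequalities cancels
   the common mean term. *)
have [t Xt td] : [set t - y ord0 i | t in X i] (x ord0 j - y ord0 j).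
  by rewrite Xij; exists (x ord0 j).
have [u Xu ud] : [set t - y ord0 j | t in X j] (x ord0 i - y ord0 i).
  by rewrite -Xij; exists (x ord0 i).
have := cost_nash_first_order Nx Xt; have := cost_nash_first_order Nx Xu.
have -> : t - x ord0 i = - (x ord0 i - y ord0 i - (x ord0 j - y ord0 j)).
  by lra.
have -> : u - x ord0 j = x ord0 i - y ord0 i - (x ord0 j - y ord0 j) by lra.
by lra.
Qed.

End ExponentialGame.

(** * From prospect-theoretic utilities to exponential costs *)

Lemma pt_nash_cost_nash (R : realType) (N M : nat) (X : 'I_N -> set R)
    (y : 'rV[R]_N) (a b : 'I_N -> R) (q xi : 'I_M -> R) (abar lambda c : R)
    (v : 'I_N -> R -> R) :
  is_distribution q -> (forall i, a i = abar) ->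
  (forall i z, v i z = 1 - expR (- lambda * z)) ->
  pt_nash X a b y q xi v (const_mx c)
    = cost_nash y X q (fun k => lambda * (xi k - c)) (lambda * abar).
Proof.
move=> [_ q_sum1] a_sym v_exp.
have utilityE i x : pt_utility a b y q xi v (const_mx c) i x =
    1 - expR (- lambda * (b i - c * y ord0 i))
      * exp_cost y q (fun k => lambda * (xi k - c)) (lambda * abar) i x.
  (* Writing [1] as the sum of the [q k] reduces the identity to one outcome, where [- c * x_i]
     splits into [- c * y_i] and a multiple of the deviation absorbed by [xi k - c]. *)
  rewrite /pt_utility /exp_cost /mgf /expect -{1}q_sum1 !mulr_sumr -sumrB.
  apply: eq_bigr => k _; rewrite v_exp mulrBr mulr1; congr (_ - _).
  rewrite [in RHS](mulrCA (expR _) (q k)) [in RHS](mulrCA _ (q k)) -!expRD.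
  congr (_ * expR _).
  by rewrite /outcome /mean_deviation a_sym mxE; ring.
rewrite /pt_nash /cost_nash; apply/seteqP; split => x [Sx x_opt];
  split=> // i t; by move/x_opt; rewrite !utilityE lerD2l lerN2 ler_pM2l ?expR_gt0.
Qed.

Theorem theorem5 (R : realType) (N : nat) (hN : (0 < N)%N)
    (X : 'I_N -> set R)
    (X_nonempty : forall i, X i !=set0)
    (X_compact : forall i, compact (X i))
    (X_convex : forall i, convex_set (X i : set R^o))
    (y : 'rV[R]_N) (a b : 'I_N -> R)
    (a_gt0 : forall i, 0 < a i) (b_ge0 : forall i, 0 <= b i)
    (M : nat) (xi q : 'I_M -> R)
    (xi_inj : injective xi)
    (q_distr : is_distribution q)
    (xi_var : 0 < finite_variance q xi)
    (abar : R) (a_sym : forall i, a i = abar)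
    (lambda : R) (lambda_gt0 : 0 < lambda)
    (v : 'I_N -> R -> R)
    (v_exp : forall i z, v i z = 1 - expR (- lambda * z))
    (p : 'rV[R]_N) (p_uniform : uniform_prices p) :
  (pt_nash X a b y q xi v p #= `I_1)%card /\
  forall x : 'rV[R]_N, pt_nash X a b y q xi v p x ->
    (forall i, interior (X i) (x ord0 i)) \/
    (forall i, [set t - y ord0 i | t in X i] =
               [set t - y ord0 (Ordinal hN) | t in X (Ordinal hN)]) ->
    forall i, x ord0 i - y ord0 i = x ord0 (Ordinal hN) - y ord0 (Ordinal hN).
Proof.
case: p_uniform => c ->.
rewrite (pt_nash_cost_nash _ _ _ _ _ q_distr a_sym v_exp).
set z := fun k => _; set kappa := lambda * abar.
have z_nonconstant : nonconstant q z.
  have [k [l [qk ql lt_kl]]] := finite_variance_nonconstant q_distr xi_var.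
  by exists k, l; split=> //; rewrite ltr_pM2l // ltrD2r.
have kappa_ge0 : 0 <= kappa.
  by rewrite mulr_ge0 ?ltW // -(a_sym (Ordinal hN)).
split=> [|x Nx sym i].
  have [x Nx] := cost_nash_exists y z kappa q_distr X_nonempty X_compact.
  suff -> : cost_nash y X q z kappa = [set x] by exact: card_set1.
  apply/seteqP; split => [x' Nx'|_ ->//].
  exact: (cost_nash_unique hN q_distr z_nonconstant kappa_ge0 X_convex Nx' Nx).
apply: (cost_nash_symmetric hN q_distr z_nonconstant X_convex Nx).
by case: sym => [Xint|Xi]; [left|right].
Qed.
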